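(* Let $L\ge 3$, $\gamma>0$, and consider the $L$-layer network $f(x,\theta)$, the cross-entropy-after-softmax loss $\ell$, the empirical loss $L_S$, and the SGD-with-weight-decay update $F$ defined in the context. Suppose that each activation function $\sigma_l$ is (sub)-differentiable, is coordinate-wise Lipschitz with constant $c_\sigma>0$, and satisfies $\sigma_l(0)=0$. Let $c_\ell>0$ be a constant such that $\ell(\cdot,y)$ is $c_\ell$-Lipschitz (in the Euclidean norm) for every $y\in[d]$. Let $0< w\le \big(\gamma/(c_\ell c_\sigma^{L})\big)^{1/(L-2)}$ and suppose that $\theta$ is initialized within the compact set $$C_w:=\{(W_0,\ldots,W_{L-1}) : \|W_l\|_{\mathrm{op}}\le w \text{ for all } l\}.$$ Let the step size satisfy $0<\eta\le 1/\gamma$. Then the SGD iterate $\theta_k$ lies in $C_w$ for every $k$, and there is a constant $C$, independent of $n$ and $\delta$, such that for every $n\ge 1$ and every $\delta\in(0,1/2]$, with probability at least $1-\delta$ the empirical measure $\mu_n=\frac1n\sum_{t=1}^n\delta_{\theta_t}$ of the SGD iterates satisfies $$\Big|\mathbb{E}_{\theta\sim\mu_n}\big[L_S(\theta)-L_S(F(\theta))\big]\Big|\le C\,\frac{\log(1/\delta)}{\sqrt{n}}.$$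
   Context: Network: for weight matrices $\theta=(W_0,\dots,W_{L-1})$ and input $x$, set $x_0=x$, $x_{l+1}=\sigma_{l+1}(W_l x_l)$ for $l=0,\dots,L-1$, and $f(x,\theta)=x_L\in\mathbb{R}^d$, where each $\sigma_l$ is a function $\mathbb{R}\to\mathbb{R}$ applied coordinate-wise. Loss: $\ell:\mathbb{R}^d\times[d]\to\mathbb{R}$ is $\ell(x,y)=x_y-\log\big(\sum_{j=1}^d e^{x_j}\big)$, where $[d]=\{1,\dots,d\}$. Data: $S=\{(x^i,y^i)\}_{i=1}^N$ with $\|x^i\|_2\le 1$ and $y^i\in[d]$. Empirical loss: $L_S(\theta)=\frac1N\sum_{i=1}^N\ell(f(x^i,\theta),y^i)$. For a minibatch $\mathcal{B}$ of $m$ examples of $S$, $L_{\mathcal{B}}(\theta)=\frac1m\sum_{i\in\mathcal{B}}\ell(f(x^i,\theta),y^i)$. Training is by SGD with weight decay, i.e. SGD on the regularized loss $L_S^\gamma(\theta)=L_S(\theta)+\frac{\gamma}{2}\|\theta\|_2^2$, where $\|\theta\|_2$ is the $\ell_2$ norm of the vectorized $\theta$. One (random) step with step size $\eta$ is $F(\theta)=(1-\eta\gamma)\theta-\eta\,\nabla_\theta L_{\mathcal{B}}(\theta)$, where $\mathcal{B}$ is a random minibatch drawn from a fixed distribution over minibatches of $S$ of size $m$. Gradients are computed by the chain rule (backpropagation), with $\sigma_l'$ denoting a chosen (sub)derivative, so $|\sigma_l'|\le c_\sigma$. The iterates are $\theta_{t+1}=F(\theta_t)$, with an independent minibatch drawn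 at each step, started from a fixed initial point $\theta_1$. $\delta_{\theta}$ denotes the Dirac measure at $\theta$. The probability is over the randomness of the SGD trajectory. In $\mathbb{E}_{\theta\sim\mu_n}[L_S(\theta)-L_S(F(\theta))]$, the expectation is over $\theta\sim\mu_n$ (the trajectory being given) and over a fresh independent minibatch in $F$, i.e. it equals $\frac1n\sum_{t=1}^n\big(L_S(\theta_t)-\mathbb{E}_F[L_S(F(\theta_t))\mid\theta_t]\big)$. *)

(* Defs.v *)
From HB Require Import structures.
From mathcomp Require Import all_boot all_order all_algebra.
From mathcomp Require Import all_classical all_reals all_analysis.

Set Implicit Arguments.
Unset Strict Implicit.
Unset Printing Implicit Defensive.
Import Order.TTheory GRing.Theory Num.Theory.
Import numFieldNormedType.Exports.

Local Open Scope classical_set_scope.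
Local Open Scope ring_scope.

(* The library's canonical norm on matrices is the max norm, hence these two. *)
Definition norm2 (R : realType) (k : nat) (v : 'cV[R]_k) : R :=
  Num.sqrt (\sum_(i < k) v i 0 ^+ 2).

Definition opnorm (R : realType) (p q : nat) (W : 'M[R]_(p, q)) : R :=
  sup [set norm2 (W *m v) | v in [set v : 'cV[R]_q | norm2 v <= 1]].

(* Clarke's generalized directional derivative
   limsup_(y -> x, t -> 0+) (f (y + t v) - f y) / t. *)
Definition clarke_dd (R : realType) (f : R -> R) (x v : R) : \bar R :=
  limf_esup (fun yt : R * R => ((f (yt.1 + yt.2 * v) - f yt.1) / yt.2)%:E)
    (filter_prod (nbhs x) (0^'+)).

Definition clarke_subdiff (R : realType) (f : R -> R) (x : R) : set R :=
  [set s | forall v : R, ((s * v)%:E <= clarke_dd f x v)%E].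

(* g is a selection of (sub)derivatives of f: the derivative wherever f is
   differentiable, an arbitrary Clarke subgradient elsewhere. For convex f the
   latter are the usual subgradients. *)
Definition is_subderivative (R : realType) (f g : R -> R) : Prop :=
  forall x, clarke_subdiff f x (g x) /\
            (derivable f x 1 -> g x = (f^`())%classic x).

(* n l is the width of layer l, for 0 <= l <= L; the number of classes is n L. *)
Definition params (R : realType) (n : nat -> nat) (L : nat) :=
  forall l : 'I_L, 'M[R]_(n l.+1, n l).

HB.instance Definition _ (R : realType) (n : nat -> nat) (L : nat) :=
  Pointed.on (params R n L).
(* The full sigma-algebra is used because arbitrary selections of subderivatives
   need not be Borel, so neither need be the SGD map; the only measures considered
   on the parameters are finite combinations of Dirac masses. *)
HB.instance Definition _ (R : realType) (n : nat -> nat) (L : nat) :=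
  @isMeasurable.Build default_measure_display (params R n L)
    discrete_measurable discrete_measurable0
    discrete_measurableC discrete_measurableU.

Section Network.
Context {R : realType} {n : nat -> nat} {L : nat}.
Implicit Types (theta : params R n L) (s ds : nat -> R -> R) (x : 'cV[R]_(n 0)).

(* W_l for l < L; the zero matrix is a dummy value for l >= L. *)
Definition weight theta (l : nat) : 'M[R]_(n l.+1, n l) :=
  if @idP (l < L)%N is ReflectT lt_lL then theta (Ordinal lt_lL) else 0.

(* s l is the activation sigma_l and ds l its chosen (sub)derivative, 1 <= l <= L *)
Fixpoint layer s theta x (l : nat) : 'cV[R]_(n l) :=
  match l with
  | 0 => x
  | l'.+1 => map_mx (s l'.+1) (weight theta l' *m layer s theta x l')
  end.

Definition network s theta x : 'cV[R]_(n L) := layer s theta x L.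

(* Given the gradient g of the loss with respect to x_l, computes the gradients
   with respect to W_0, ..., W_(l-1); e is the gradient with respect to the
   preactivation W_(l-1) x_(l-1). *)
Fixpoint backprop s ds theta x (l : nat) :
    'cV[R]_(n l) -> forall k : nat, 'M[R]_(n k.+1, n k) :=
  match l with
  | 0 => fun _ _ => 0
  | l'.+1 => fun g =>
      let z := weight theta l' *m layer s theta x l' in
      let e := \col_i (ds l'.+1 (z i 0) * g i 0) in
      dfwith (backprop s ds theta x ((weight theta l')^T *m e))
             l' (e *m (layer s theta x l')^T)
  end.

End Network.

Definition loss (R : realType) (d : nat) (x : 'cV[R]_d) (y : 'I_d) : R :=
  x y 0 - ln (\sum_(j < d) expR (x j 0)).

Definition grad_loss (R : realType) (d : nat) (x : 'cV[R]_d) (y : 'I_d) :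
    'cV[R]_d :=
  \col_i 'D_(delta_mx i 0) (fun u : 'cV[R]_d => loss u y) x.

Section SGD.
Context {R : realType} {n : nat -> nat} {L N m : nat}.
Variables (s ds : nat -> R -> R).
Variables (xs : 'I_N -> 'cV[R]_(n 0)) (ys : 'I_N -> 'I_(n L)).
Implicit Types (theta : params R n L) (b : m.-tuple 'I_N).

Definition emp_loss theta : R :=
  N%:R^-1 * \sum_(i < N) loss (network s theta (xs i)) (ys i).

(* A minibatch is given by the m-tuple of the indices of its examples; sampling
   with and without replacement are both distributions over such tuples. *)
Definition batch_grad b theta : params R n L := fun l : 'I_L =>
  m%:R^-1 *: \sum_(i <- b)
    backprop s ds theta (xs i)
      (grad_loss (network s theta (xs i)) (ys i)) l.

Definition sgd_step (gamma eta : R) b theta : params R n L := fun l : 'I_L =>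
  (1 - eta * gamma) *: theta l - eta *: batch_grad b theta l.

(* Index shift: sgd ... t is the iterate theta_(t+1), produced from
   theta_1 by the minibatches bs 0, ..., bs (t-1). *)
Fixpoint sgd (gamma eta : R) (theta1 : params R n L)
    (bs : nat -> m.-tuple 'I_N) (t : nat) : params R n L :=
  match t with
  | 0 => theta1
  | t'.+1 => sgd_step gamma eta (bs t') (sgd gamma eta theta1 bs t')
  end.

(* E_F[L_S(theta) - L_S(F(theta))], a fresh minibatch having mass function p *)
Definition expected_decrease (p : m.-tuple 'I_N -> R) (gamma eta : R) theta : R :=
  \sum_b p b * (emp_loss theta - emp_loss (sgd_step gamma eta b theta)).

End SGD.

Definition C_ball (R : realType) (n : nat -> nat) (L : nat) (w : R) :
    set (params R n L) :=
  [set theta | forall l : 'I_L, opnorm (theta l) <= w].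

(* (1/k) sum_(t < k) delta_(u t) *)
Definition empirical_measure (R : realType) d (T : measurableType d)
    (u : nat -> T) (k : nat) : {measure set T -> \bar R} :=
  mscale (k%:R^-1%:nng : {nonneg R}) (msum (fun t => dirac (u t)) k).

Definition is_pmf (R : realType) (T : finType) (p : T -> R) : Prop :=
  (forall a, 0 <= p a) /\ \sum_a p a = 1.

Definition mutually_independent (R : realType) d (Omega : measurableType d)
    (P : probability Omega R) (T : Type) (X : nat -> Omega -> T) : Prop :=
  forall (I : seq nat) (A : nat -> set T), uniq I ->
    P (\bigcap_(t in [set` I]) (X t @^-1` A t)) =
    (\prod_(t <- I) P (X t @^-1` A t))%E.

Definition iid (R : realType) d (Omega : measurableType d)
    (P : probability Omega R) (T : finType) (X : nat -> Omega -> T)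
    (p : T -> R) : Prop :=
  [/\ forall t (A : set T), measurable (X t @^-1` A),
      forall t a, P (X t @^-1` [set a]) = (p a)%:E &
      mutually_independent P X].

(* Main.v *)
Require Import Defs.
From mathcomp Require Import all_boot all_order all_algebra.
From mathcomp Require Import all_classical all_reals all_analysis.
From mathcomp Require Import measurable_realfun.
From mathcomp Require Import ring lra zify.

(** If every weight matrix has operator norm at most [w], the forward pass gives
    [|x_l| <= (cs w)^l] and backpropagation multiplies the gradient by at most
    [cs w] per layer, so each block of the gradient is bounded by
    [cl cs^L w^(L-1)] in operator norm. The choice of [w] makes this at most
    [gamma w], whence [|F(W)| <= (1 - eta gamma) w + eta gamma w = w].

    On the invariant set the empirical loss is bounded by some [B]. Telescoping,
    the sum over [t <= n] of [L_S(theta_t) - E_F[L_S(F(theta_t))]] is a boundary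
    term of size at most [2B] plus a martingale with increments at most [2B]. An
    Azuma-type bound on its exponential moment, at the scale [1/sqrt n], gives
    tails of order [sqrt n log(1/delta)]. *)

Set Implicit Arguments.
Unset Strict Implicit.
Unset Printing Implicit Defensive.
Import Order.TTheory GRing.Theory Num.Theory.
Import numFieldNormedType.Exports.
Local Open Scope classical_set_scope.
Local Open Scope ring_scope.

(** * Euclidean and operator norms *)

Section EuclideanNorm.
Context {R : realType}.
Implicit Types (p q : nat) (c : R).

Lemma norm2_ge0 p (v : 'cV[R]_p) : 0 <= norm2 v.
Proof. exact: sqrtr_ge0. Qed.

Lemma sqr_norm2 p (v : 'cV[R]_p) : norm2 v ^+ 2 = \sum_(i < p) v i 0 ^+ 2.
Proof. by rewrite sqr_sqrtr// sumr_ge0// => i _; exact: sqr_ge0. Qed.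

Lemma norm2_0 p : norm2 (0 : 'cV[R]_p) = 0.
Proof. by rewrite /norm2 big1 ?sqrtr0// => i _; rewrite mxE expr0n. Qed.

Lemma norm2_eq0 p (v : 'cV[R]_p) : norm2 v = 0 -> v = 0.
Proof.
move=> v0; have := sqr_norm2 v; rewrite v0 expr0n/= => /esym/eqP.
rewrite psumr_eq0 => [/allP v0'|i _]; last exact: sqr_ge0.
apply/colP => i; rewrite mxE; apply/eqP.
by have := v0' i (mem_index_enum i); rewrite sqrf_eq0.
Qed.

Lemma norm2Z p a (v : 'cV[R]_p) : norm2 (a *: v) = `|a| * norm2 v.
Proof.
rewrite /norm2 -sqrtr_sqr -sqrtrM ?sqr_ge0//; congr Num.sqrt.
by rewrite mulr_sumr; apply: eq_bigr => i _; rewrite mxE exprMn.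
Qed.

(** Cauchy-Schwarz, from expanding the nonnegative sum of the
    [(norm2 v * u i 0 - norm2 u * v i 0) ^+ 2]. *)
Lemma dot_le_norm2 p (u v : 'cV[R]_p) :
  \sum_(i < p) u i 0 * v i 0 <= norm2 u * norm2 v.
Proof.
have [u0|u0] := eqVneq (norm2 u) 0.
  by rewrite u0 mul0r (norm2_eq0 u0) big1// => i _; rewrite mxE mul0r.
have [v0|v0] := eqVneq (norm2 v) 0.
  by rewrite v0 mulr0 (norm2_eq0 v0) big1// => i _; rewrite mxE mulr0.
have uv0 : 0 < norm2 u * norm2 v by rewrite mulr_gt0// lt_def norm2_ge0 ?u0 ?v0.
have : 0 <= \sum_(i < p) (norm2 v * u i 0 - norm2 u * v i 0) ^+ 2.
  by apply: sumr_ge0 => i _; exact: sqr_ge0.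
rewrite (eq_bigr (fun i => norm2 v ^+ 2 * u i 0 ^+ 2 + norm2 u ^+ 2 * v i 0 ^+ 2
   - (2 * (norm2 u * norm2 v)) * (u i 0 * v i 0))); last by move=> i _; ring.
rewrite sumrB big_split/= -!mulr_sumr -!sqr_norm2 subr_ge0.
rewrite (_ : _ + _ = 2 * (norm2 u * norm2 v) * (norm2 u * norm2 v)); last ring.
by rewrite ler_pM2l// mulr_gt0.
Qed.

Lemma norm2D p (u v : 'cV[R]_p) : norm2 (u + v) <= norm2 u + norm2 v.
Proof.
rewrite -ler_sqr ?nnegrE ?addr_ge0 ?norm2_ge0// sqr_norm2.
rewrite (eq_bigr (fun i => u i 0 ^+ 2 + v i 0 ^+ 2 + 2 * (u i 0 * v i 0))).
  rewrite !big_split/= -mulr_sumr -!sqr_norm2.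
  by have := dot_le_norm2 u v; nra.
by move=> i _; rewrite mxE; ring.
Qed.

Lemma norm2_sum p (I : Type) (r : seq I) (F : I -> 'cV[R]_p) :
  norm2 (\sum_(i <- r) F i) <= \sum_(i <- r) norm2 (F i).
Proof.
elim/big_ind2 : _ => [|x a y b xa yb|i _]; rewrite ?norm2_0//.
by rewrite (le_trans (norm2D _ _))// lerD.
Qed.

Lemma normr_dot_le p (u v : 'cV[R]_p) :
  `|\sum_(i < p) u i 0 * v i 0| <= norm2 u * norm2 v.
Proof.
rewrite ler_norml dot_le_norm2 andbT lerNl.
have := dot_le_norm2 (-1 *: u) v; rewrite norm2Z normrN1 mul1r; apply: le_trans.
by rewrite -sumrN ler_sum// => i _; rewrite mxE mulN1r mulNr.
Qed.

(** The witness is the Frobenius norm. Any finite bound would do: it makes the set under the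
    supremum in [opnorm] bounded above, so that [sup] really is an upper bound. *)
Lemma norm2_mulmx_bounded p q (W : 'M[R]_(p, q)) :
  exists c, forall v, norm2 (W *m v) <= c * norm2 v.
Proof.
exists (Num.sqrt (\sum_(i < p) norm2 (row i W)^T ^+ 2)) => v.
have F0 : 0 <= \sum_(i < p) norm2 (row i W)^T ^+ 2.
  by apply: sumr_ge0 => i _; exact: sqr_ge0.
rewrite -[leRHS]ger0_norm ?mulr_ge0 ?sqrtr_ge0 ?norm2_ge0//.
rewrite -sqrtr_sqr ler_wsqrtr// exprMn sqr_sqrtr// mulr_suml ler_sum// => i _.
rewrite mxE -exprMn -[leLHS]real_normK ?num_real//.
rewrite ler_sqr ?nnegrE ?mulr_ge0 ?norm2_ge0//.
rewrite (eq_bigr (fun j => (row i W)^T j 0 * v j 0)) ?normr_dot_le// => j _.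
by rewrite !mxE.
Qed.

Lemma norm2_mulmx_opnorm p q (W : 'M[R]_(p, q)) v :
  norm2 (W *m v) <= opnorm W * norm2 v.
Proof.
have [c cW] := norm2_mulmx_bounded W.
have [v0|v0] := eqVneq (norm2 v) 0.
  by rewrite v0 mulr0 (norm2_eq0 v0) mulmx0 norm2_0.
have v_gt0 : 0 < norm2 v by rewrite lt_def v0 norm2_ge0.
rewrite -ler_pdivrMr// mulrC -[(norm2 v)^-1]ger0_norm ?invr_ge0 ?norm2_ge0//.
rewrite -norm2Z scalemxAr; apply: ub_le_sup.
  (* The constant [c] comes without a sign, hence the maximum with 0. *)
  exists (Num.max c 0) => _ [u u1 <-]; rewrite (le_trans (cW u))//.
  have [c0|c0] := leP 0 c.
    by rewrite -[leRHS]mulr1 ler_wpM2l.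
  by rewrite mulr_le0_ge0 ?(ltW c0)// norm2_ge0.
exists ((norm2 v)^-1 *: v) => //=.
by rewrite norm2Z ger0_norm ?invr_ge0 ?norm2_ge0// mulVf.
Qed.

Lemma opnorm_leP p q (W : 'M[R]_(p, q)) c : 0 <= c ->
  opnorm W <= c <-> forall v, norm2 (W *m v) <= c * norm2 v.
Proof.
move=> c0; split=> [Wc v|Wc].
  by rewrite (le_trans (norm2_mulmx_opnorm W v))// ler_wpM2r// norm2_ge0.
apply: ge_sup; first by exists (norm2 (W *m 0)); exists 0 => //=; rewrite norm2_0.
move=> _ [v v1 <-]; rewrite (le_trans (Wc v))//.
by rewrite -[leRHS]mulr1 ler_wpM2l.
Qed.

(** Duality: with [z = W^T *m u], the square of [norm2 z] is the inner product of [u] with [W *m z],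
    hence at most [norm2 u * (c * norm2 z)]; then divide by [norm2 z]. Backpropagation multiplies by
    transposed weights. *)
Lemma norm2_trmx_mulmx p q (W : 'M[R]_(p, q)) c : 0 <= c ->
  (forall v, norm2 (W *m v) <= c * norm2 v) ->
  forall u, norm2 (W^T *m u) <= c * norm2 u.
Proof.
move=> c0 Wc u; set z := W^T *m u.
have [->|z0] := eqVneq (norm2 z) 0; first by rewrite mulr_ge0// norm2_ge0.
have zz : norm2 z * norm2 z = \sum_(i < p) u i 0 * (W *m z) i 0.
  rewrite -expr2 sqr_norm2.
  transitivity ((z^T *m z) 0 0).
    by rewrite mxE; apply: eq_bigr => i _; rewrite !mxE expr2.
  by rewrite /z trmx_mul trmxK -mulmxA mxE; apply: eq_bigr => i _; rewrite [_^T _ _]mxE.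
have z_gt0 : 0 < norm2 z by rewrite lt_def z0 norm2_ge0.
rewrite -(ler_pM2r z_gt0) zz (le_trans (dot_le_norm2 _ _))//.
by rewrite [leRHS]mulrAC mulrC ler_wpM2r// norm2_ge0.
Qed.

(** Each block of the gradient is such an outer product of a backpropagated error and a layer
    output. *)
Lemma norm2_rank_one p q (e : 'cV[R]_p) (x v : 'cV[R]_q) :
  norm2 (e *m x^T *m v) <= norm2 e * norm2 x * norm2 v.
Proof.
have -> : e *m x^T *m v = (\sum_(i < q) x i 0 * v i 0) *: e.
  rewrite -mulmxA; apply/colP => i; rewrite [LHS]mxE big_ord1 mulrC [RHS]mxE.
  by rewrite mxE; congr (_ * _); apply: eq_bigr => j _; rewrite mxE.
by rewrite norm2Z -mulrA mulrC ler_wpM2l ?norm2_ge0// normr_dot_le.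
Qed.

Lemma norm2_le_coord p (u v : 'cV[R]_p) c : 0 <= c ->
  (forall i, `|u i 0| <= c * `|v i 0|) -> norm2 u <= c * norm2 v.
Proof.
move=> c0 uv; rewrite -(ger0_norm c0) -norm2Z ler_wsqrtr// ler_sum// => i _.
rewrite -[leLHS]real_normK ?num_real// -[leRHS]real_normK ?num_real//.
by rewrite ler_sqr ?nnegrE// mxE normrM (ger0_norm c0).
Qed.

End EuclideanNorm.

(** * Subderivatives and the gradient of the loss *)

(** Every difference quotient with [t > 0] is at most [c * |v|], hence so is the Clarke derivative;
    the directions 1 and -1 bound [g x] from both sides. *)
Lemma lipschitz_subderivative_le {R : realType} (f g : R -> R) (c : R) :
  (forall a b, `|f a - f b| <= c * `|a - b|) -> is_subderivative f g ->
  forall x, `|g x| <= c.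
Proof.
move=> flip fg x; have [gx _] := fg x.
suff H v : (clarke_dd f x v <= (c * `|v|)%:E)%E.
  have := le_trans (gx 1) (H 1); have := le_trans (gx (-1)) (H (-1)).
  by rewrite !lee_fin normrN1 normr1 !mulr1 mulrN1 ler_norml => ? ->; lra.
rewrite /clarke_dd /limf_esup.
apply: (@le_trans _ _ (ereal_sup [set ((f (yt.1 + yt.2 * v) - f yt.1) / yt.2)%:E
    | yt in setT `*` [set t : R | 0 < t]])).
  apply: ereal_inf_lbound; exists (setT `*` [set t : R | 0 < t]) => //.
  exists (setT, [set t : R | 0 < t]) => //=; split; first exact: filterT.
  exact: nbhs_right_gt.
apply: ge_ereal_sup => _ [[y t] [_ /= t0] <-]; rewrite lee_fin.
rewrite ler_pdivrMr// (le_trans (ler_norm _))// (le_trans (flip _ _))//.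
by rewrite addrAC subrr add0r normrM (gtr0_norm t0) -mulrA [t * _]mulrC.
Qed.

Section Loss.
Context {R : realType} {d : nat}.
Implicit Types (y : 'I_d) (x v u : 'cV[R]_d).

(** The directional derivative of the loss at [x] along [v]: the coordinate [v y 0] minus the
    softmax average of [v]. *)
Definition loss_slope x y v : R :=
  v y 0 - (\sum_(j < d) expR (x j 0))^-1 * \sum_(j < d) v j 0 * expR (x j 0).

Lemma is_derive_loss_line x y v :
  is_derive (0 : R) (1 : R) (fun t : R => loss (t *: v + x) y) (loss_slope x y v).
Proof.
have S_gt0 : 0 < \sum_(j < d) expR (x j 0).
  rewrite (bigD1 y)//= ltr_pwDl ?expR_gt0// sumr_ge0// => j _; exact: expR_ge0.
have dl (j : 'I_d) : is_derive (0 : R) (1 : R) (fun t : R => (t *: v + x) j 0) (v j 0).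
  have -> : (fun t : R => (t *: v + x) j 0) = (fun t : R => t * v j 0 + x j 0).
    by apply/funext => t; rewrite !mxE.
  by apply: is_derive_eq; rewrite scaler0 add0r addr0 [_ *: _]mulr1.
have de (j : 'I_d) : is_derive (0 : R) (1 : R)
    (fun t : R => expR ((t *: v + x) j 0)) (v j 0 * expR (x j 0)).
  have := @is_derive1_comp R expR (fun t : R => (t *: v + x) j 0) 0 _ _
    (is_derive_expR _) (dl j).
  by rewrite scale0r add0r mulrC.
have dS : is_derive (0 : R) (1 : R) (fun t : R => \sum_(j < d) expR ((t *: v + x) j 0))
    (\sum_(j < d) v j 0 * expR (x j 0)).
  have := @is_derive_sum _ _ _ d _ _ _ _ de.
  by congr is_derive; apply/funext => t; rewrite fct_sumE.
have dln : is_derive (\sum_(j < d) expR (x j 0)) (1 : R) (@ln R)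
    (\sum_(j < d) expR (x j 0))^-1.
  exact: is_derive1_ln.
rewrite /loss_slope; apply: is_deriveB.
apply: is_derive1_comp dS.
by under eq_bigr do rewrite scale0r add0r.
Qed.

Lemma is_derive_loss x y v :
  is_derive x v (fun u => loss u y) (loss_slope x y v).
Proof.
have [D E] := is_derive_loss_line x y v.
(* The directional difference quotient at [x] is the ordinary one of the loss restricted to the line
   through [x]. *)
have eq : (fun h : R => h^-1 *:
      (((fun t : R => loss (t *: v + x) y) \o shift 0) (h *: 1) - loss (0 *: v + x) y)) =
    (fun h => h^-1 *: (((fun u => loss u y) \o shift x) (h *: v) - loss x y)).
  by apply/funext => h /=; rewrite addr0 scale0r add0r [h *: 1]mulr1.
split.
  by move: D; rewrite /derivable eq.
by rewrite -E /derive eq.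
Qed.

(** The slope along the gradient [g] itself is [norm2 g ^+ 2], while the Lipschitz condition bounds
    it by [c * norm2 g]. *)
Lemma norm2_grad_loss x y c : 0 <= c ->
  (forall u v, `|loss u y - loss v y| <= c * norm2 (u - v)) ->
  norm2 (grad_loss x y) <= c.
Proof.
move=> c0 lip; set g := grad_loss x y.
have gE i : g i 0 = (i == y)%:R - (\sum_(j < d) expR (x j 0))^-1 * expR (x i 0).
  transitivity (loss_slope x y (delta_mx i 0)).
    by rewrite mxE; exact: (@derive_val _ _ _ _ _ _ _ (is_derive_loss x y _)).
  rewrite /loss_slope mxE eqxx andbT eq_sym; congr (_ - _ * _).
  rewrite (bigD1 i)//= mxE !eqxx mul1r.
  by rewrite big1 ?addr0// => j /negbTE ji; rewrite mxE ji mul0r.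
have slope_g : loss_slope x y g = norm2 g ^+ 2.
  rewrite sqr_norm2 /loss_slope.
  transitivity (\sum_(i < d) (g i 0 * (i == y)%:R -
     (\sum_(j < d) expR (x j 0))^-1 * (g i 0 * expR (x i 0)))).
    rewrite sumrB -mulr_sumr; congr (_ - _); rewrite (bigD1 y)//= eqxx mulr1.
    by rewrite big1 ?addr0// => i /negbTE ->; rewrite mulr0.
  by apply: eq_bigr => i _; rewrite expr2 [in RHS](gE i) mulrCA -mulrBr -gE.
have slope_le : loss_slope x y g <= c * norm2 g.
  have [dg <-] := is_derive_loss x y g.
  apply: limr_le => //; near=> h; rewrite /= -[_ *: _]/(_ * _).
  have h0 : h != 0 by near: h; exact: nbhs_dnbhs_neq.
  rewrite (le_trans (ler_norm _))// normrM normfV ler_pdivrMl ?normr_gt0//.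
  rewrite (le_trans (lip _ _))// addrK norm2Z.
  by rewrite mulrCA.
have [->//|g0] := eqVneq (norm2 g) 0.
have g_gt0 : 0 < norm2 g by rewrite lt_def g0 norm2_ge0.
by rewrite -(ler_pM2r g_gt0) -expr2 -slope_g.
Unshelve. all: by end_near.
Qed.

End Loss.

(** * Invariance of the operator-norm ball under SGD *)

Section BoundedWeights.
Context {R : realType} {n : nat -> nat} {L : nat}.
Variables (s ds : nat -> R -> R) (cs w : R).
Hypotheses (cs_ge0 : 0 <= cs) (w_ge0 : 0 <= w).
Hypothesis s0 : forall l, (0 < l <= L)%N -> s l 0 = 0.
Hypothesis s_lip : forall l, (0 < l <= L)%N ->
  forall a b, `|s l a - s l b| <= cs * `|a - b|.
Hypothesis ds_le : forall l, (0 < l <= L)%N -> forall a, `|ds l a| <= cs.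
Variable theta : params R n L.
Hypothesis theta_w : C_ball w theta.

(** The dummy zero weights satisfy the bound too, so no condition [l < L] is carried along. *)
Lemma norm2_weight_mulmx l v : norm2 (weight theta l *m v) <= w * norm2 v.
Proof.
rewrite /weight; case: {-}_ / idP => [lL|_].
  exact: (iffLR (opnorm_leP (theta (Ordinal lL)) w_ge0) (theta_w (Ordinal lL)) v).
by rewrite mul0mx norm2_0 mulr_ge0// norm2_ge0.
Qed.

Lemma norm2_layer x l : (l <= L)%N ->
  norm2 (layer s theta x l) <= (cs * w) ^+ l * norm2 x.
Proof.
elim: l => [|l IHl] lL /=; first by rewrite mul1r.
rewrite exprS -!mulrA.
apply: (@le_trans _ _ (cs * norm2 (weight theta l *m layer s theta x l))).
  apply: norm2_le_coord => // i; rewrite mxE.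
  (* Since [s] vanishes at 0, the Lipschitz bound becomes linear growth. *)
  by rewrite -[s _ _]subr0 -(s0 (l := l.+1))// -[X in _ * `|X|]subr0 s_lip.
rewrite ler_wpM2l// (le_trans (norm2_weight_mulmx _))// ler_wpM2l//.
exact: IHl (ltnW lL).
Qed.

(** For [k < l] the forward pass contributes [cs ^+ k * w ^+ k] and the backward pass
    [cs ^+ (l - k) * w ^+ (l.-1 - k)], so the product does not depend on [k]. For [k >= l] the block
    is 0. *)
Lemma norm2_backprop x : norm2 x <= 1 -> forall l, (l <= L)%N ->
  forall (g : 'cV_(n l)) k v, norm2 (backprop s ds theta x g k *m v) <=
    cs ^+ l * w ^+ l.-1 * norm2 g * norm2 v.
Proof.
move=> x1; elim=> [|l IHl] lL g k v /=.
  by rewrite mul0mx norm2_0 !mulr_ge0// norm2_ge0.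
set e := \col_i _.
have e_le : norm2 e <= cs * norm2 g.
  by apply: norm2_le_coord => // i; rewrite mxE normrM ler_wpM2r// ds_le.
have [kl|kl] := eqVneq k l.
  move: v; rewrite kl => v; rewrite dfwithin (le_trans (norm2_rank_one _ _ _))//.
  rewrite ler_wpM2r ?norm2_ge0//.
  have x_le : norm2 (layer s theta x l) <= (cs * w) ^+ l.
    rewrite (le_trans (norm2_layer x (ltnW lL)))// -[leRHS]mulr1 ler_wpM2l//.
    by rewrite exprn_ge0// mulr_ge0.
  apply: (le_trans (ler_pM (norm2_ge0 _) (norm2_ge0 _) e_le x_le)).
  by rewrite exprMn exprS le_eqVlt; apply/orP; left; apply/eqP; ring.
rewrite dfwithout 1?eq_sym//.
(* The exponent [l.-1] is truncated at [l = 0], where the remaining blocks are 0; otherwise the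
   transposed weight supplies the extra factor [w]. *)
case: l IHl lL g @e e_le kl => [|l] IHl lL g e e_le kl.
  by rewrite /= mul0mx norm2_0 !mulr_ge0 ?exprn_ge0// norm2_ge0.
rewrite (le_trans (IHl (ltnW lL) _ _ _))// ler_wpM2r ?norm2_ge0//=.
have We_le := norm2_trmx_mulmx w_ge0 (@norm2_weight_mulmx l.+1) e.
have {}We_le := le_trans We_le (ler_wpM2l w_ge0 e_le).
apply: (le_trans (ler_wpM2l _ We_le)); first by rewrite mulr_ge0// exprn_ge0.
by rewrite !exprS le_eqVlt; apply/orP; left; apply/eqP; ring.
Qed.

End BoundedWeights.

Section SGDInvariance.
Context {R : realType} {n : nat -> nat} {L N m : nat}.
Variables (s ds : nat -> R -> R).
Variables (xs : 'I_N -> 'cV[R]_(n 0)) (ys : 'I_N -> 'I_(n L)).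
Variables (cs cl w gamma eta : R).
Hypotheses (cs_ge0 : 0 <= cs) (cl_ge0 : 0 <= cl) (w_ge0 : 0 <= w).
Hypothesis s0 : forall l, (0 < l <= L)%N -> s l 0 = 0.
Hypothesis s_lip : forall l, (0 < l <= L)%N ->
  forall a b, `|s l a - s l b| <= cs * `|a - b|.
Hypothesis ds_le : forall l, (0 < l <= L)%N -> forall a, `|ds l a| <= cs.
Hypothesis loss_lip : forall (y : 'I_(n L)) u v,
  `|loss u y - loss v y| <= cl * norm2 (u - v).
Hypothesis xs1 : forall i, norm2 (xs i) <= 1.

Lemma norm2_batch_grad theta (b : m.-tuple 'I_N) l v : (0 < m)%N ->
  C_ball w theta ->
  norm2 (batch_grad s ds xs ys b theta l *m v) <=
    cl * cs ^+ L * w ^+ L.-1 * norm2 v.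
Proof.
move=> m_gt0 theta_w; rewrite /batch_grad -scalemxAl norm2Z mulmx_suml.
rewrite ger0_norm ?invr_ge0// ler_pdivrMl ?ltr0n//.
apply: (le_trans (norm2_sum _ _)).
apply: (@le_trans _ _ (\sum_(i <- b) cl * cs ^+ L * w ^+ L.-1 * norm2 v)).
  apply: ler_sum => i _.
  apply: (le_trans (norm2_backprop cs_ge0 w_ge0 s0 s_lip ds_le theta_w (xs1 i)
     (leqnn L) _ _)).
  rewrite ler_wpM2r ?norm2_ge0// mulrC -[leRHS]mulrA ler_wpM2r ?mulr_ge0 ?exprn_ge0//.
  by apply: norm2_grad_loss.
by rewrite big_const_seq count_predT size_tuple iter_addr_0 mulr_natl.
Qed.

(** One factor [w] split off the gradient bound leaves at most [gamma * w]; the step is then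
    controlled by the convex combination [(1 - eta * gamma) * w + eta * gamma * w]. *)
Lemma C_ball_sgd_step theta b : (0 < m)%N -> 0 < w -> (2 <= L)%N ->
  cl * cs ^+ L * w ^+ (L - 2) <= gamma -> 0 <= eta -> eta * gamma <= 1 ->
  C_ball w theta ->
  C_ball w (sgd_step (m := m) s ds xs ys gamma eta b theta).
Proof.
move=> m_gt0 w_gt0 L2 w_le eta0 eta1 theta_w l; apply/opnorm_leP => // v.
rewrite /sgd_step mulmxBl -scalemxAl -[(eta *: _) *m _]scalemxAl (le_trans (norm2D _ _))//.
rewrite -[X in _ + norm2 X]scaleNr !norm2Z normrN (ger0_norm eta0) ger0_norm ?subr_ge0//.
have Wv := iffLR (opnorm_leP (theta l) w_ge0) (theta_w l) v.
have Gv := norm2_batch_grad b v m_gt0 theta_w.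
have := ler_wpM2l eta0 Gv.
have := ler_wpM2l (_ : 0 <= 1 - eta * gamma) Wv.
rewrite subr_ge0 => /(_ eta1).
have -> : w ^+ L.-1 = w ^+ (L - 2) * w by rewrite -exprSr; congr (_ ^+ _); lia.
have : eta * (cl * cs ^+ L * w ^+ (L - 2)) * (w * norm2 v) <= eta * gamma * (w * norm2 v).
  by rewrite ler_wpM2r ?mulr_ge0 ?norm2_ge0// ler_wpM2l.
move: (norm2 (theta l *m v)) (norm2 (_ *m _)) (norm2 v) (cs ^+ _) (w ^+ _).
by move=> /= *; lra.
Qed.

(** The network output is bounded on the ball, so the Lipschitz loss stays close to its value at
    output 0, whose modulus is the second summand of the witness. *)
Lemma emp_loss_bounded : exists B : R,
  forall theta, C_ball w theta -> `|emp_loss s xs ys theta| <= B.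
Proof.
exists (cl * (cs * w) ^+ L + `|ln (\sum_(j < n L) expR (0 : R))|) => theta theta_w.
(* With no data the inverse of 0 is 0, so the empirical loss is 0. *)
have [N0|N_gt0] := posnP N.
  have -> : emp_loss s xs ys theta = 0.
    by rewrite /emp_loss (_ : N%:R^-1 = 0) ?mul0r// N0 invr0.
  rewrite normr0.
  by rewrite addr_ge0// !mulr_ge0// exprn_ge0// mulr_ge0.
rewrite /emp_loss normrM ger0_norm ?invr_ge0// ler_pdivrMl ?ltr0n//.
rewrite (le_trans (ler_norm_sum _ _ _))// mulr_natl -[in leRHS](card_ord N) -sumr_const.
apply: ler_sum => i _; set u := network _ _ _.
rewrite -[loss _ _](subrK (loss 0 (ys i))) (le_trans (ler_normD _ _))// lerD//.
  rewrite (le_trans (loss_lip _ _ _))// subr0 ler_wpM2l//.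
  rewrite (le_trans (norm2_layer cs_ge0 w_ge0 s0 s_lip theta_w _ (leqnn L)))//.
  by rewrite -[leRHS]mulr1 ler_wpM2l// exprn_ge0// mulr_ge0.
rewrite /loss mxE add0r normrN.
by under eq_bigr do rewrite mxE.
Qed.

End SGDInvariance.

(** * Concentration along a chain driven by independent draws *)

Lemma Rintegral_empirical_measure {R : realType} d (T : measurableType d)
    (u : nat -> T) k (f : T -> R) : measurable_fun setT f ->
  (\int[empirical_measure R u k]_x f x = k%:R^-1 * \sum_(t < k) f (u t))%R.
Proof.
move=> mf.
(* Nonnegative integrands first; a signed one is then split into its positive and negative parts. *)
have H (g : T -> R) : measurable_fun setT g -> (forall x, 0 <= g x) ->
    (\int[empirical_measure R u k]_x (g x)%:E = (k%:R^-1 * \sum_(t < k) g (u t))%:E)%E.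
  move=> mg g0; have mg' := iffRL (measurable_EFinP _ _) mg.
  rewrite ge0_integral_mscale//=; last by move=> x _; rewrite lee_fin.
  rewrite ge0_integral_measure_sum//=; last by move=> x _; rewrite lee_fin.
  rewrite EFinM -sumEFin; congr (_ * _)%E; apply: eq_bigr => t _.
  by rewrite integral_dirac//= diracT mul1e.
rewrite /Rintegral integralE -[fun x => (f x)%:E]/(EFin \o f) funerpos funerneg.
rewrite !H//=; [|exact: measurable_funrneg|exact: measurable_funrpos].
rewrite -mulrBr -sumrB; congr (_ * _); apply: eq_bigr => t _.
exact: (congr1 (fun g => g (u t)) (funrposBneg f)).
Qed.

(** From [1 - x <= expR (- x)] follows [expR x <= (1 - x)^-1], and the right-hand side times [1 - x]
    is [1 + x ^+ 2 * (1 - 2 * x) >= 1]. *)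
Lemma expR_le_quadratic {R : realType} (x : R) : x <= 2^-1 ->
  expR x <= 1 + x + 2 * x ^+ 2.
Proof.
move=> x2; have := expR_ge1Dx (- x); rewrite expRN => ex.
have x1 : 0 < 1 - x by lra.
have e0 := expR_gt0 x.
have {}ex : expR x * (1 - x) <= 1 by move: ex; rewrite -[leRHS]mul1r ler_pdivlMr// mulrC.
rewrite -(ler_pM2r x1) (le_trans ex)//.
have -> : (1 + x + 2 * x ^+ 2) * (1 - x) = 1 + x ^+ 2 * (1 - 2 * x) by ring.
by rewrite lerDl mulr_ge0// ?sqr_ge0//; lra.
Qed.

(** Lets additive constants be absorbed into multiples of [ln delta^-1]; it rests on
    [expR 2^-1 <= 2]. *)
Lemma half_le_lnV {R : realType} (x : R) : 0 < x -> x <= 2^-1 -> 2^-1 <= ln x^-1.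
Proof.
move=> x0 x2; rewrite -ler_expR lnK ?posrE ?invr_gt0//.
apply: (@le_trans _ _ 2); last by rewrite -[leLHS]invrK lef_pV2 ?posrE ?invr_gt0.
by apply: (le_trans (expR_le_quadratic (lexx _))); lra.
Qed.

Lemma sum_tuple_cons {R : realType} (T : finType) k (F : seq T -> R) :
  \sum_(h : k.+1.-tuple T) F h = \sum_(h : k.-tuple T) \sum_(b : T) F (b :: h).
Proof.
rewrite pair_big/=.
rewrite (reindex (fun hb : k.-tuple T * T => cons_tuple hb.2 hb.1))//=.
exists (fun h : k.+1.-tuple T => (behead_tuple h, thead h)) => [[h b] _|h _] /=.
  by congr pair; exact: val_inj.
by apply: val_inj => /=; rewrite [in RHS](tuple_eta h).
Qed.

(** * The law of the first draws as a product weight on tuples *)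

Section Concentration.
Context {R : realType} {d : measure_display} {Omega : measurableType d}.
Variables (P : probability Omega R) (T : finType).
Variables (X : nat -> Omega -> T) (p : T -> R).
Hypotheses (p_pmf : is_pmf p) (X_iid : iid P X p).

(* Most recent draw first. *)
Fixpoint history (t : nat) (omega : Omega) : seq T :=
  if t is t'.+1 then X t' omega :: history t' omega else [::].

Lemma size_history t omega : size (history t omega) = t.
Proof. by elim: t => //= t ->. Qed.

Let pmf_ge0 b : 0 <= p b. Proof. by case: p_pmf. Qed.

Lemma measurable_history t h : measurable [set omega | history t omega = h].
Proof.
have [mX _ _] := X_iid; elim: t h => [|t IHt] h /=.
  case: h => [|b h].
    by rewrite (_ : mkset _ = setT)//; apply/seteqP; split.
  by rewrite (_ : mkset _ = set0)//; apply/seteqP; split.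
case: h => [|b h]; first by rewrite (_ : mkset _ = set0)//; apply/seteqP; split.
rewrite (_ : mkset _ = (X t @^-1` [set b]) `&` [set omega | history t omega = h]).
  by apply: measurableI.
by apply/seteqP; split => omega /= [-> ->].
Qed.

(** The events on later draws strengthen the induction: each step moves the latest draw of the
    history into [I], and at the empty history mutual independence applies. *)
Lemma prob_history_cylinder t h (I : seq nat) (A : nat -> set T) :
  size h = t -> uniq I -> (forall i, i \in I -> (t <= i)%N) ->
  P ([set omega | history t omega = h] `&`
     \bigcap_(i in [set` I]) (X i @^-1` A i)) =
  ((\prod_(b <- h) p b)%:E * \prod_(i <- I) P (X i @^-1` A i))%E.
Proof.
have [_ X_p X_ind] := X_iid.
elim: t h I A => [|t IHt] [|b h]// I A.
  move=> _ I_uniq _; rewrite big_nil mul1e -X_ind//; congr (P _).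
  by rewrite -[RHS]setTI; congr (_ `&` _); apply/seteqP; split.
move=> [ht] I_uniq I_ge.
pose A' i := if i == t then [set b] else A i.
have tI : t \notin I by apply/negP => /I_ge; rewrite ltnn.
have A'E i : i \in I -> A' i = A i.
  by rewrite /A'; case: eqP => // -> tI'; rewrite tI' in tI.
transitivity (P ([set omega | history t omega = h] `&`
     \bigcap_(i in [set` t :: I]) (X i @^-1` A' i))).
  congr (P _); apply/seteqP; split => omega /=.
    move=> [[Xb hh] XA]; split => // i /=; rewrite inE => /orP[/eqP ->|iI].
      by rewrite /A' eqxx.
    by rewrite A'E//; exact: XA.
  move=> [hh XA]; split.
    by congr cons => //; have := XA t; rewrite /= inE eqxx /A' eqxx; apply.
  by move=> i /= iI; rewrite -A'E//; apply: XA => /=; rewrite inE iI orbT.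
rewrite IHt//=; last 2 first.
- by rewrite tI.
- by move=> i; rewrite inE => /orP[/eqP -> //|/I_ge/ltnW].
rewrite !big_cons {1}/A' eqxx X_p muleA -EFinM mulrC; congr (_ * _)%E.
by apply: eq_big_seq => i iI; rewrite A'E.
Qed.

Lemma prob_history k (h : k.-tuple T) :
  P [set omega | history k omega = h] = (\prod_(b <- h) p b)%:E.
Proof.
have := @prob_history_cylinder k h [::] (fun=> setT).
rewrite size_tuple big_nil mule1 => <-//; congr (P _).
by rewrite -[LHS]setIT; congr (_ `&` _); apply/seteqP; split.
Qed.

(** Turns probabilities of events on the first [k] draws into finite weighted sums, on which the
    tail estimates are carried out. *)
Lemma prob_history_in k (Q : pred (seq T)) :
  P [set omega | Q (history k omega)] =
  (\sum_(h : k.-tuple T | Q h) \prod_(b <- h) p b)%:E.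
Proof.
rewrite -sumEFin; under eq_bigr do rewrite -prob_history.
rewrite -big_filter fsbig_seq ?filter_uniq ?index_enum_uniq//.
rewrite -measure_fin_bigcup//.
- congr (P _); apply/seteqP; split => omega /=.
    move=> Qh; exists (Tuple (introT eqP (size_history k omega))) => //=.
    by rewrite mem_filter mem_index_enum andbT.
  by move=> [h /=]; rewrite mem_filter => /andP[Qh _] ->.
- by move=> h1 h2 _ _ [omega [/= ->]] /val_inj.
- by move=> h _; exact: measurable_history.
Qed.

Lemma sum_history_weight k : \sum_(h : k.-tuple T) \prod_(b <- h) p b = 1.
Proof.
have [_ p1] := p_pmf; elim: k => [|k IHk].
  by rewrite (big_pred1 [tuple]) ?big_nil// => h; apply/esym/eqP; exact: tuple0.
apply: etrans IHk; rewrite (sum_tuple_cons _ (fun h => \prod_(b <- h) p b)).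
apply: eq_bigr => h _.
transitivity (\sum_b p b * \prod_(c <- h) p c).
  by apply: eq_bigr => b _; rewrite big_cons.
by rewrite -mulr_suml p1 mul1r.
Qed.

(** Averaging out the most recent draw costs a factor [c]; this finite sum plays the role of a
    conditional expectation. *)
Lemma sum_history_le_expn k (G : seq T -> R) c : 0 <= c ->
  (forall h, \sum_b p b * G (b :: h) <= c * G h) ->
  \sum_(h : k.-tuple T) (\prod_(b <- h) p b) * G h <= c ^+ k * G [::].
Proof.
move=> c0 Gc; elim: k => [|k IHk].
  by rewrite (big_pred1 [tuple]) ?big_nil// => h; apply/esym/eqP; exact: tuple0.
rewrite (sum_tuple_cons _ (fun h => (\prod_(b <- h) p b) * G h)).
rewrite exprS -mulrA (le_trans _ (ler_wpM2l c0 IHk))// mulr_sumr ler_sum// => h _.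
have -> : \sum_b (\prod_(c <- b :: h) p c) * G (b :: h) =
    \sum_b (\prod_(c <- h) p c) * (p b * G (b :: h)).
  by apply: eq_bigr => b _; rewrite big_cons; ring.
rewrite -mulr_sumr mulrCA ler_wpM2l//; exact: prodr_ge0.
Qed.

(** * Exponential moments and tails of a martingale with bounded increments *)

Section Martingale.
Variables (M : seq T -> R) (K : R).
Hypotheses (K_gt0 : 0 < K) (M0 : M [::] = 0).
Hypothesis M_fair : forall h, \sum_b p b * (M (b :: h) - M h) = 0.
Hypothesis M_step : forall b h, `|M (b :: h) - M h| <= K.

(** In the quadratic bound on the exponential of an increment the linear term averages to 0, so each
    draw costs at most [1 + 2 * (|l| * K) ^+ 2], itself at most the exponential of
    [2 * (|l| * K) ^+ 2]. *)
Lemma sum_expR_martingale k l : `|l| * K <= 2^-1 ->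
  \sum_(h : k.-tuple T) (\prod_(b <- h) p b) * expR (l * M h) <=
    expR (k%:R * (2 * (`|l| * K) ^+ 2)).
Proof.
move=> lK; have [_ p1] := p_pmf.
rewrite expRM_natl.
have := @sum_history_le_expn k (fun h => expR (l * M h))
  (expR (2 * (`|l| * K) ^+ 2)) (expR_ge0 _).
rewrite M0 mulr0 expR0 mulr1; apply.
move=> h; apply: (@le_trans _ _ (\sum_b p b *
    (expR (l * M h) * (1 + l * (M (b :: h) - M h) + 2 * (`|l| * K) ^+ 2)))).
  apply: ler_sum => b _; rewrite ler_wpM2l//.
  rewrite -[M (b :: h)](subrK (M h)) [_ + M h]addrC mulrDr expRD ler_wpM2l ?expR_ge0//.
  rewrite [M h + _ - _]addrAC subrr add0r.
  have D_le : `|l * (M (b :: h) - M h)| <= `|l| * K by rewrite normrM ler_wpM2l.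
  apply: le_trans (expR_le_quadratic _) _.
    by rewrite (le_trans (ler_norm _))// (le_trans D_le).
  rewrite lerD2l ler_pM2l// -[leLHS]real_normK ?num_real//.
  by rewrite lerXn2r ?nnegrE// (le_trans _ D_le).
rewrite (eq_bigr (fun b => expR (l * M h) * (1 + 2 * (`|l| * K) ^+ 2) * p b +
   expR (l * M h) * l * (p b * (M (b :: h) - M h)))); last by move=> b _; ring.
rewrite big_split/= -!mulr_sumr p1 M_fair mulr0 addr0 mulr1 mulrC.
by rewrite ler_wpM2r ?expR_ge0// expR_ge1Dx.
Qed.

Lemma martingale_concentration k delta : (0 < k)%N -> 0 < delta <= 2^-1 ->
  ((1 - delta)%:E <= P [set omega |
    `|M (history k omega)| <= 6 * K * Num.sqrt k%:R * ln delta^-1]%R)%E.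
Proof.
move=> k_gt0 /andP[delta0 delta2]; set a := 6 * K * _ * _.
rewrite (@prob_history_in k (fun h => `|M h| <= a)) lee_fin.
have := sum_history_weight k; rewrite (bigID (fun h : k.-tuple T => `|M h| <= a))/=.
suff : \sum_(h : k.-tuple T | ~~ (`|M h| <= a)) \prod_(b <- h) p b <= delta by lra.
set S := Num.sqrt _ in a *.
have S_gt0 : 0 < S by rewrite sqrtr_gt0 ltr0n.
(* This scale makes both exponential moments at most [expR 2^-1], and the 6 in [a] makes
   [expR (- (l * a))] equal to [delta ^+ 3]. *)
pose l := (2 * K * S)^-1.
have l_gt0 : 0 < l by rewrite invr_gt0 !mulr_gt0.
have la : l * a = 3 * ln delta^-1.
  by rewrite /l /a; field; rewrite !gt_eqF.
have lK : l * K = 2^-1 / S by rewrite /l; field; rewrite !gt_eqF.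
have lK2 : k%:R * (2 * (l * K) ^+ 2) = 2^-1.
  rewrite lK exprMn [S^-1 ^+ 2]exprVn sqr_sqrtr//; field.
  by rewrite pnatr_eq0 -lt0n.
have lK_le : l * K <= 2^-1.
  rewrite lK ler_pdivrMr// ler_peMr// -[leLHS]sqrtr1 ler_wsqrtr// ler1n//.
have nl : `|l| = l by rewrite ger0_norm// ltW.
have e1 := @sum_expR_martingale k l; have e2 := @sum_expR_martingale k (- l).
rewrite normrN nl lK2 in e1 e2.
have {}e1 := e1 lK_le; have {}e2 := e2 lK_le.
pose q (h : k.-tuple T) := \prod_(b <- h) p b.
have q0 h : 0 <= q h by exact: prodr_ge0.
(* Markov's inequality for both tails at once *)
apply: (@le_trans _ _ (\sum_(h : k.-tuple T)
    expR (- (l * a)) * (q h * expR (l * M h) + q h * expR (- l * M h)))).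
  rewrite big_mkcond/= ler_sum// => h _; case: ifPn => [|_]; last first.
    by rewrite mulr_ge0 ?addr_ge0 ?mulr_ge0 ?expR_ge0.
  rewrite -ltNge -mulrDr mulrCA -[leLHS]mulr1 => aM.
  rewrite -/(q h) ler_wpM2l// mulrDr -!expRD.
  have [M_ge0|M_lt0] := leP 0 (M h).
    rewrite ger0_norm// in aM; rewrite -[leLHS]addr0 lerD ?expR_ge0//.
    by rewrite -expR0 ler_expR addrC subr_ge0 ler_wpM2l ?ltW.
  rewrite ltr0_norm// in aM; rewrite -[leLHS]add0r lerD ?expR_ge0//.
  by rewrite -expR0 ler_expR addrC subr_ge0 mulNr -mulrN ler_wpM2l ?ltW.
rewrite -mulr_sumr big_split/=.
apply: (le_trans (ler_wpM2l (expR_ge0 _) (lerD e1 e2))).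
(* As [expR 2^-1 <= delta^-1], both tails together weigh at most [2 * delta ^+ 2], which is at most
   [delta] because [delta <= 2^-1]. *)
have ln_ge := half_le_lnV delta0 delta2.
have e_le : expR (2^-1 : R) <= expR (ln delta^-1) by rewrite ler_expR.
rewrite la (_ : - _ = ln (delta ^+ 3)); last first.
  by rewrite lnXn// lnV ?posrE// -mulr_natr; ring.
rewrite lnK ?posrE ?exprn_gt0//.
rewrite lnK ?posrE ?invr_gt0// in e_le.
have d3 : 0 <= delta ^+ 3 by rewrite exprn_ge0// ltW.
apply: (le_trans (ler_wpM2l d3 (lerD e_le e_le))).
rewrite (_ : _ * _ = 2 * delta * delta); last by field; rewrite gt_eqF.
by rewrite -[leRHS]mul1r (ler_wpM2r (ltW delta0))//; lra.
Qed.

End Martingale.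

(** * Doob decomposition of a bounded function along the chain *)

Section MeanDecrease.
Variables (S : Type) (step : T -> S -> S) (x0 : S) (V : S -> R) (B : R).
Hypotheses (B_gt0 : 0 < B) (V_le : forall h, `|V (foldr step x0 h)| <= B).

Definition mean_decrease (x : S) : R := \sum_b p b * (V x - V (step b x)).

(** The head draw is dropped before evaluating: each term depends only on the state before the draw,
    which makes the sum predictable. *)
Fixpoint compensator (h : seq T) : R :=
  if h is _ :: h' then mean_decrease (foldr step x0 h') + compensator h' else 0.

Lemma compensator_history k omega : compensator (history k omega) =
  \sum_(t < k) mean_decrease (foldr step x0 (history t omega)).
Proof.
by elim: k => [|k IHk]; rewrite ?big_ord0// big_ord_recr/= -IHk addrC.
Qed.

Lemma mean_decrease_concentration k delta : (0 < k)%N -> 0 < delta <= 2^-1 ->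
  ((1 - delta)%:E <= P [set omega |
    `|\sum_(t < k) mean_decrease (foldr step x0 (history t omega))| <=
      16 * B * Num.sqrt k%:R * ln delta^-1]%R)%E.
Proof.
move=> k_gt0 delta_int; have [_ p1] := p_pmf.
(* The martingale part of the Doob decomposition of V along the chain. *)
pose M h := V (foldr step x0 h) - V x0 + compensator h.
have dM b h : M (b :: h) - M h =
    V (foldr step x0 (b :: h)) - \sum_c p c * V (foldr step x0 (c :: h)).
  have -> : M (b :: h) - M h =
      V (foldr step x0 (b :: h)) - V (foldr step x0 h) + mean_decrease (foldr step x0 h).
    by rewrite /M /=; ring.
  rewrite /mean_decrease; under eq_bigr do rewrite mulrBr.
  by rewrite sumrB -mulr_suml p1 mul1r addrA subrK.
have B2 : 0 < 2 * B by rewrite mulr_gt0.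
have M0 : M [::] = 0 by rewrite /M /= addr0 subrr.
have M_fair h : \sum_b p b * (M (b :: h) - M h) = 0.
  under eq_bigr do rewrite dM mulrBr.
  by rewrite sumrB -mulr_suml p1 mul1r subrr.
have M_step b h : `|M (b :: h) - M h| <= 2 * B.
  rewrite dM (le_trans (ler_normB _ _))// mulr2n mulrDl !mul1r lerD//.
  rewrite (le_trans (ler_norm_sum _ _ _))// -[leRHS]mul1r -p1 mulr_suml ler_sum// => c _.
  by rewrite normrM ger0_norm// ler_wpM2l.
under eq_set do rewrite -compensator_history.
apply: (le_trans (martingale_concentration B2 M0 M_fair M_step k_gt0 delta_int)).
(* Inclusion of the two events is checked tuple by tuple on the weights. *)
rewrite (prob_history_in k (fun h => `|M h| <= 6 * (2 * B) * Num.sqrt k%:R * ln delta^-1)).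
rewrite (prob_history_in k
  (fun h => `|compensator h| <= 16 * B * Num.sqrt k%:R * ln delta^-1)).
rewrite lee_fin [leLHS]big_mkcond [leRHS]big_mkcond/= ler_sum// => h _.
have q0 : 0 <= \prod_(b <- h) p b by exact: prodr_ge0.
case: ifPn => [Mh|_]; last by case: ifP.
rewrite ifT//.
(* The martingale contributes 12 to the constant 16. The boundary term is at most [2 * B], and
   [Num.sqrt k%:R * ln delta^-1 >= 2^-1] turns it into the remaining 4. *)
have -> : compensator h = M h - (V (foldr step x0 h) - V x0) by rewrite /M; ring.
rewrite (le_trans (ler_normB _ _))//.
have VV : `|V (foldr step x0 h) - V x0| <= B + B.
  by rewrite (le_trans (ler_normB _ _))// lerD//; exact: (V_le [::]).
have k_ge1 : 1 <= Num.sqrt (k%:R : R).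
  by rewrite -[leLHS]sqrtr1 ler_wsqrtr// ler1n.
have [delta0 delta2] := andP delta_int.
have ln_ge := half_le_lnV delta0 delta2.
have : 1 * 2^-1 <= Num.sqrt k%:R * ln delta^-1 by rewrite ler_pM.
by move=> /(ler_wpM2l (ltW B_gt0)); lra.
Qed.

End MeanDecrease.
End Concentration.

(** Raising the hypothesis to the positive power [L - 2] removes the real exponent, giving the form
    used for the invariance of the ball. *)
Lemma expn_le_of_le_powR {R : realType} (w c gamma : R) L : (2 < L)%N ->
  0 <= w -> 0 < c -> 0 <= gamma -> w <= (gamma / c) `^ (L%:R - 2)^-1 ->
  c * w ^+ (L - 2) <= gamma.
Proof.
move=> L2 w0 c0 g0 w_le; rewrite mulrC -ler_pdivlMr// -powR_mulrn// natrB 1?ltnW//.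
have e0 : 0 < L%:R - 2 :> R by rewrite subr_gt0 ltr_nat.
have gc : 0 <= gamma / c by rewrite divr_ge0// ltW.
have := ge0_ler_powR (ltW e0) _ _ w_le; rewrite !nnegrE w0 powR_ge0 => /(_ isT isT).
by rewrite -powRrM mulVf ?gt_eqF// powRr1.
Qed.

Theorem theorem4p3 (R : realType) (n : nat -> nat) (L N m : nat)
    (s ds : nat -> R -> R)
    (xs : 'I_N -> 'cV[R]_(n 0%N)) (ys : 'I_N -> 'I_(n L))
    (p : m.-tuple 'I_N -> R)
    (disp : measure_display) (Omega : measurableType disp)
    (P : probability Omega R) (bs : nat -> Omega -> m.-tuple 'I_N)
    (gamma eta cs cl w : R) (theta1 : params R n L)
    (hL : (3 <= L)%N) (hN : (0 < N)%N) (hm : (0 < m)%N)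
    (hgamma : 0 < gamma)
    (hcs : 0 < cs)
    (hds : forall l : nat, (0 < l <= L)%N -> is_subderivative (s l) (ds l))
    (hlip : forall l : nat, (0 < l <= L)%N ->
       forall a b : R, `|s l a - s l b| <= cs * `|a - b|)
    (hs0 : forall l : nat, (0 < l <= L)%N -> s l 0 = 0)
    (hcl : 0 < cl)
    (hloss : forall (y : 'I_(n L)) (u v : 'cV[R]_(n L)),
       `|loss u y - loss v y| <= cl * norm2 (u - v))
    (hxs : forall i, norm2 (xs i) <= 1)
    (hp : is_pmf p)
    (hbs : iid P bs p)
    (hw0 : 0 < w)
    (hw : w <= (gamma / (cl * cs ^+ L)) `^ (L%:R - 2)^-1)
    (htheta1 : @C_ball R n L w theta1)
    (heta0 : 0 < eta) (heta : eta <= gamma^-1) :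
  let theta (omega : Omega) : nat -> params R n L :=
    sgd s ds xs ys gamma eta theta1 (fun t => bs t omega) in
  (forall (omega : Omega) (k : nat), C_ball w (theta omega k)) /\
  exists C : R, forall (k : nat) (delta : R),
    (1 <= k)%N -> 0 < delta <= 2^-1 ->
    ((1 - delta)%:E <=
     P [set omega |
        (`| \int[empirical_measure R (theta omega) k]_u
             expected_decrease s ds xs ys p gamma eta u |
        <= C * (ln delta^-1 / Num.sqrt k%:R))%R])%E.
Proof.
move=> theta.
have hds' l : (0 < l <= L)%N -> forall a, `|ds l a| <= cs.
  by move=> hl; apply: lipschitz_subderivative_le (hlip l hl) (hds l hl).
have gain : cl * cs ^+ L * w ^+ (L - 2) <= gamma.
  by apply: expn_le_of_le_powR hw => //; rewrite ?ltW// mulr_gt0// exprn_gt0.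
have eta_gamma : eta * gamma <= 1 by rewrite -ler_pdivlMr// mul1r.
have step_in t (b : m.-tuple 'I_N) :
    C_ball w t -> C_ball w (sgd_step s ds xs ys gamma eta b t).
  move=> t_w; exact: (C_ball_sgd_step ys (ltW hcs) (ltW hcl) (ltW hw0) hs0 hlip
    hds' hloss hxs b hm hw0 (ltnW hL) gain (ltW heta0) eta_gamma t_w).
split.
  by move=> omega k; rewrite /theta; elim: k => //= k; exact: step_in.
have [B0 B0_le] := emp_loss_bounded ys (ltW hcs) (ltW hcl) (ltW hw0) hs0 hlip hloss hxs.
(* The maximum with 1 gives the strict positivity that the concentration bound asks for. *)
pose B := Num.max 1 B0.
have B_gt0 : 0 < B by rewrite lt_max ltr01.
pose step (b : m.-tuple 'I_N) t := sgd_step s ds xs ys gamma eta b t.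
pose V := emp_loss s xs ys.
have V_le h : `|V (foldr step theta1 h)| <= B.
  rewrite le_max B0_le ?orbT//.
  by elim: h => //= b h; exact: step_in.
(* [foldr] applies the tail of the list first, so a history with the latest draw at its head replays
   the draws in chronological order. *)
have thetaE omega t : theta omega t = foldr step theta1 (history bs t omega).
  elim: t => [|t IHt]; first by [].
  exact: (congr1 (step (bs t omega)) IHt).
exists (16 * B) => k delta k_gt0 delta_int.
have := mean_decrease_concentration hp hbs B_gt0 V_le k_gt0 delta_int.
congr (_ <= P _)%E; apply/funext => omega /=; congr (is_true _).
(* Measurability is immediate, as the parameters carry the full sigma-algebra. *)
rewrite Rintegral_empirical_measure; last by move=> _ A _.
under [in RHS]eq_bigr do rewrite thetaE.
rewrite normrM ger0_norm ?invr_ge0// ler_pdivrMl ?ltr0n//.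
have k_sqr : k%:R = Num.sqrt k%:R * Num.sqrt k%:R :> R by rewrite -expr2 sqr_sqrtr.
congr (_ <= _).
have S_gt0 : 0 < Num.sqrt k%:R :> R by rewrite sqrtr_gt0 ltr0n.
move: S_gt0 k_sqr; set S := Num.sqrt _ => S_gt0 ->; field.
by rewrite gt_eqF.
Qed.
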